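(* Let $\ell\ge 1$, $0\le r\le\ell$, let $n_1,\dots,n_\ell\ge 0$ be integers and set $\alpha=n_1\gamma_1+\dots+n_\ell\gamma_\ell$. Let $$\chi^{\alpha}_{W(\Lambda_r)}(q)=\sum_{i} q^{i}\,\operatorname{card}\{\,b \mid b\,v_r\in\mathcal B,\ w(b)=\alpha,\ d(b)=i\,\}$$ be the character counting the monomials $b$ of weight $\alpha$ in the monomial basis $\mathcal B$ of the Feigin-Stoyanovsky's type subspace $W(\Lambda_r)$ by degree. Then $$\chi^{\alpha}_{W(\Lambda_r)}(q)=\frac{q^{\sum_{i=1}^{\ell} n_i^2+\sum_{1\le i<j\le \ell} n_in_j+\sum_{i=1}^{r} n_i}}{(q)_{n_1}(q)_{n_2}\cdots(q)_{n_\ell}},$$ where $(q)_n=(1-q)(1-q^2)\cdots(1-q^n)$.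
   Context: Let $\mathfrak g=\mathfrak{sl}_{\ell+1}(\mathbb C)$ with Cartan subalgebra $\mathfrak h$, root system $R$, basis of simple roots $\{\alpha_1,\dots,\alpha_\ell\}$ (in the standard numbering of type $A_\ell$), fundamental weights $\omega_1,\dots,\omega_\ell$, $\omega_0=0$, and normalized invariant bilinear form $\langle\cdot,\cdot\rangle$. For each root $\alpha$ a nonzero root vector $x_\alpha\in\mathfrak g_\alpha$ is fixed. The affine Lie algebra is $\tilde{\mathfrak g}=\tilde{\mathfrak{sl}}_{\ell+1}(\mathbb C)=\mathfrak g\otimes\mathbb C[t,t^{-1}]\oplus\mathbb C c\oplus\mathbb C d$, the usual untwisted affine algebra: writing $x(m)=x\otimes t^m$, one has $[x(m),y(n)]=[x,y](m+n)+m\,\delta_{m+n,0}\langle x,y\rangle c$, $c$ is central, $[d,x(m)]=m\,x(m)$. Its fundamental weights are $\Lambda_0,\dots,\Lambda_\ell$. $L(\Lambda_r)$ is the standard (integrable irreducible highest weight) $\tilde{\mathfrak g}$-module of level $1$ with highest weight $\Lambda_r$, and $v_r$ is its highest weight vector. Set $\gamma_i=\alpha_i+\dots+\alpha_\ell$ for $i=1,\dots,\ell$; these are exactly the roots $\alpha$ with $\langle\alpha,\omega_\ell\rangle=1$. Let $\mathfrak g_1=\sum_{i=1}^\ell\mathfrak g_{\gamma_i}$ and $\tilde{\mathfrak g}_1=\mathfrak g_1\otimes\mathbb C[t,t^{-1}]$, a commutative subalgebra of $\tilde{\mathfrak g}$. Write $x_i(m)=x_{\gamma_i}(m)$. The Feigin-Stoyanovsky's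 type subspace is $W(\Lambda_r)=U(\tilde{\mathfrak g}_1)\cdot v_r$. Consider monomials $$b=x_\ell(-m_{\ell,n_\ell})\cdots x_\ell(-m_{\ell,1})\cdots x_1(-m_{1,n_1})\cdots x_1(-m_{1,1}),\qquad n_i\ge 0,\quad m_{i,n+1}\ge m_{i,n}>0$$ ($n_i=0$ means no factors $x_i(\cdot)$; the empty monomial $b=1$ is allowed). The degree of $b$ is $d(b)=\sum_{i=1}^\ell\sum_{n=1}^{n_i} m_{i,n}$ and its weight is $w(b)=n_1\gamma_1+\dots+n_\ell\gamma_\ell$. The monomial basis $\mathcal B$ of $W(\Lambda_r)$ (indexed by the monomials $b$) consists of the vectors $b\,v_r$ for all monomials $b$ satisfying the initial conditions $m_{j,n}\ge 1+\sum_{i<j}n_i+\delta_{j\le r}$ for $1\le j\le\ell$, $1\le n\le n_j$, and the difference conditions $m_{j,n+1}\ge m_{j,n}+2$ for $1\le j\le\ell$, $1\le n\le n_j-1$. Here $\delta_{j\le r}$ equals $1$ if $j\le r$ and $0$ otherwise. *)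

(* Defs.v *)
From HB Require Import structures.
From mathcomp Require Import all_boot all_order all_algebra finmap.
From mathcomp Require Import boolp classical_sets functions cardinality.

Set Implicit Arguments.
Unset Strict Implicit.
Unset Printing Implicit Defensive.

Import Order.TTheory GRing.Theory Num.Theory.
Local Open Scope classical_set_scope.
Local Open Scope ring_scope.

(* Indices are 0-based: j : 'I_l stands for the mathematical
   index j.+1, so "i < j" is unchanged while "j <= r" becomes j < r. *)

(* The roots of sl_(l+1) in the usual realization inside Z^(l+1):
   simple_root i is e_i - e_(i+1). *)
Definition simple_root (l : nat) (i : 'I_l) : 'rV[int]_l.+1 :=
  delta_mx 0 (widen_ord (leqnSn l) i) - delta_mx 0 (lift ord0 i).

Definition gamma (l : nat) (i : 'I_l) : 'rV[int]_l.+1 :=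
  \sum_(j < l | (i <= j)%N) simple_root j.

(* A monomial b in the x_j(-m), m > 0, is recorded by the exponent sequences
   b j = [:: m_{j,1}; ...; m_{j,n_j}].  Since the x_j(-m) commute, each
   monomial is represented exactly once by weakly increasing sequences. *)
Definition is_monomial (l : nat) (m : {ffun 'I_l -> seq nat}) : bool :=
  [forall j, sorted leq (m j) && all (leq 1) (m j)].

Record monomial (l : nat) : Type := Monomial {
  exponents :> {ffun 'I_l -> seq nat};
  _ : is_monomial exponents }.

HB.instance Definition _ (l : nat) := [isSub for @exponents l].
HB.instance Definition _ (l : nat) := [Countable of monomial l by <:].

Definition mon_degree (l : nat) (b : monomial l) : nat :=
  (\sum_(j < l) \sum_(m <- b j) m)%N.

Definition mon_weight (l : nat) (b : monomial l) : 'rV[int]_l.+1 :=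
  \sum_(j < l) gamma j *+ size (b j).

Definition initial_conditions (l r : nat) (b : monomial l) : Prop :=
  forall (j : 'I_l) (n : nat), (n < size (b j))%N ->
    (1 + \sum_(i < l | (i < j)%N) size (b i) + (j < r) <= nth 0 (b j) n)%N.

Definition difference_conditions (l : nat) (b : monomial l) : Prop :=
  forall (j : 'I_l) (n : nat), (n.+1 < size (b j))%N ->
    (nth 0 (b j) n + 2 <= nth 0 (b j) n.+1)%N.

(* The index set of the basis B of W(Lambda_r).  B is a family indexed by
   monomials: "b v_r is in B" refers to the monomial b, not just to the vector
   b v_r, because distinct monomials may give the same vector: for l = 2, r = 0 one has
   x_2(-2) x_1(-3) x_1(-2) v_0 = x_2(-3) x_1(-3) x_1(-1) v_0, and only the
   second monomial satisfies the difference conditions. *)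
Definition basis_monomials (l r : nat) : set (monomial l) :=
  [set b | initial_conditions r b /\ difference_conditions b].

(* Formal power series in q over Z are identified with their coefficient
   functions nat -> int. *)
Definition fps : Type := nat -> int.

(* Coefficient k counts the basis monomials of weight alpha and degree k.
   fset_set is meaningful only on finite sets: see finite_basis_monomials. *)
Definition character (l r : nat) (alpha : 'rV[int]_l.+1) : fps := fun k =>
  (#|` fset_set [set b : monomial l | [/\ basis_monomials r b,
       mon_weight b = alpha & mon_degree b = k]] |%fset)%:Z.

Lemma finite_mon_degree (l k : nat) :
  finite_set [set b : monomial l | mon_degree b = k].
Proof.
have mon1 : is_monomial [ffun _ : 'I_l => [::]].
  by apply/forallP => j; rewrite ffunE.
pose T : finType := {ffun 'I_l -> k.-bseq 'I_k.+1}.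
pose g (F : T) : monomial l :=
  insubd (Monomial mon1) [ffun j => [seq val m | m <- F j]].
apply: (@sub_finite_set _ _ (g @` setT)); last first.
  exact/finite_image/finite_finset.
move=> b /= db.
have bP : is_monomial b := valP b.
have le_k j : (\sum_(m <- b j) m <= k)%N.
  by rewrite -db /mon_degree (bigD1 j) //= leq_addr.
have szb j : (size (b j) <= k)%N.
  apply: leq_trans (le_k j); have /andP[_] := forallP bP j.
  elim: (b j) => [|m s IHs] //= /andP[m1 /IHs s1].
  by rewrite big_cons -add1n leq_add.
have lt_k j m : m \in b j -> (m < k.+1)%N.
  move=> mb; rewrite ltnS; apply: leq_trans (le_k j).
  by rewrite (big_rem m) //= leq_addr.
have szF j : (size [seq inord m : 'I_k.+1 | m <- b j] <= k)%N by rewrite size_map.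
exists [ffun j => Bseq (szF j)] => //; apply: val_inj; rewrite /g.
suff -> : [ffun j => [seq val m | m <- [ffun j => Bseq (szF j)] j]] = val b.
  by rewrite valKd.
apply/ffunP => j; rewrite !ffunE /= -map_comp -[RHS]map_id.
by apply/eq_in_map => m /lt_k mk /=; rewrite inordK.
Qed.

Lemma finite_basis_monomials (l r k : nat) (alpha : 'rV[int]_l.+1) :
  finite_set [set b : monomial l | [/\ basis_monomials r b,
    mon_weight b = alpha & mon_degree b = k]].
Proof. by apply: sub_finite_set (finite_mon_degree l k) => b []. Qed.

Definition fps_mul (f g : fps) : fps := fun k => \sum_(i < k.+1) f i * g (k - i)%N.

Definition fps_of_poly (p : {poly int}) : fps := fun k => p`_k.

(* First k coefficients of the power series p / d, for d with constant
   coefficient 1, by long division. *)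
Fixpoint fps_div_prefix (p d : {poly int}) (k : nat) : seq int :=
  if k is k'.+1 then
    let s := fps_div_prefix p d k' in
    rcons s (p`_k' - \sum_(i < k') s`_i * d`_(k' - i))
  else [::].

Definition fps_div (p d : {poly int}) : fps := fun k => (fps_div_prefix p d k.+1)`_k.

Lemma size_fps_div_prefix p d k : size (fps_div_prefix p d k) = k.
Proof. by elim: k => //= k IHk; rewrite size_rcons IHk. Qed.

Lemma nth_fps_div_prefix p d k i : (i < k)%N ->
  (fps_div_prefix p d k)`_i = fps_div p d i.
Proof.
elim: k => // k IHk; rewrite ltnS leq_eqVlt => /predU1P[-> //|ik].
by rewrite /= nth_rcons size_fps_div_prefix ik IHk.
Qed.

Lemma fps_divE p d k :
  fps_div p d k = p`_k - \sum_(i < k) fps_div p d i * d`_(k - i).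
Proof.
rewrite {1}/fps_div /= nth_rcons size_fps_div_prefix ltnn eqxx.
by congr (_ - _); apply: eq_bigr => i _; rewrite nth_fps_div_prefix.
Qed.

(* fps_div p d is the unique power series f with f * d = p. *)
Lemma fps_divP (p d : {poly int}) (f : fps) : d`_0 = 1 ->
  fps_mul f (fps_of_poly d) = fps_of_poly p <-> f = fps_div p d.
Proof.
move=> d0; have mulE g k : fps_mul g (fps_of_poly d) k =
    \sum_(i < k) g i * d`_(k - i) + g k.
  by rewrite /fps_mul big_ord_recr /= /fps_of_poly subnn d0 mulr1.
split=> [fd|->]; apply/funext => k; last by rewrite mulE fps_divE addrC subrK.
elim/ltn_ind: k => k IHk; rewrite fps_divE.
have := congr1 (@^~ k) fd; rewrite mulE /fps_of_poly => <-.
under [X in X + _ - _]eq_bigr => i _ do rewrite IHk //.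
by rewrite addrC addKr.
Qed.

Definition qpoch (n : nat) : {poly int} := \prod_(1 <= k < n.+1) (1 - 'X^k).

Lemma qpoch_prod_coef0 (l : nat) (n : 'I_l -> nat) :
  (\prod_(i < l) qpoch (n i))`_0 = 1.
Proof.
rewrite -horner_coef0 horner_prod big1 // => i _.
rewrite /qpoch horner_prod big_nat_cond big1 // => k /andP[/andP[k0 _] _].
by rewrite !hornerE expr0n gtn_eqF // subr0.
Qed.

(* Main.v *)
(* The weight fixes the number n_j of factors x_j(-m), so the initial and
   difference conditions decouple: row j ranges freely over the sequences of
   n_j integers with gaps at least 2 and first entry at least
   c_j = 1 + sum_(i < j) n_i + [j < r].  If R(n, c) denotes the generating
   function of such rows, splitting according to whether the first entry is c
   gives R(n+1, c) = q^c R(n, c+2) + R(n+1, c+1), and by induction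
   (q)_n R(n, c) = q^(n(n-1) + nc).  To stay with polynomials, entries are
   bounded by c + d and the identity holds modulo q^(c+d). *)
Require Import Defs.
From mathcomp Require Import all_boot all_order all_algebra finmap.
From mathcomp Require Import boolp classical_sets cardinality.
From mathcomp Require Import zify ring.

Set Implicit Arguments.
Unset Strict Implicit.
Unset Printing Implicit Defensive.

Import Order.TTheory GRing.Theory Num.Theory.
Local Open Scope ring_scope.

(** * Congruence of polynomials modulo a power of the variable *)

Definition eqmodX (R : nzRingType) (N : nat) (p q : {poly R}) : Prop :=
  forall k, (k < N)%N -> p`_k = q`_k.

Lemma eqmodX_le (R : nzRingType) M N (p q : {poly R}) :
  (M <= N)%N -> eqmodX N p q -> eqmodX M p q.
Proof. by move=> MN pq k kM; apply: pq; apply: leq_trans MN. Qed.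

Lemma eqmodXD (R : nzRingType) N (p q p' q' : {poly R}) :
  eqmodX N p q -> eqmodX N p' q' -> eqmodX N (p + p') (q + q').
Proof. by move=> pq pq' k kN; rewrite !coefD pq ?pq'. Qed.

Lemma eqmodXM (R : nzRingType) N (p q p' q' : {poly R}) :
  eqmodX N p q -> eqmodX N p' q' -> eqmodX N (p * p') (q * q').
Proof.
move=> pq pq' k kN; rewrite !coefM; apply: eq_bigr => -[i /= ik] _.
by rewrite pq ?pq' //; lia.
Qed.

Lemma eqmodX_prod (R : nzRingType) (I : finType) N (F G : I -> {poly R}) :
  (forall i, eqmodX N (F i) (G i)) -> eqmodX N (\prod_i F i) (\prod_i G i).
Proof. by move=> FG; elim/big_ind2: _ => // *; apply: eqmodXM. Qed.

Lemma eqmodX0Xn (R : nzRingType) N e :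
  (N <= e)%N -> eqmodX N 0 ('X^e : {poly R}).
Proof. by move=> Ne k kN; rewrite coef0 coefXn; case: eqP => //; lia. Qed.

(** * Rows with gaps at least 2 and their generating polynomials *)

Definition gap2 (x y : nat) : bool := (x + 2 <= y)%N.

Lemma gap2_trans : transitive gap2.
Proof. by move=> y x z; rewrite /gap2; lia. Qed.

(* All entries lie in [c, c + d).  After a first entry c the others lie in
   [c + 2, c + d), whose length d - 2 is written d'.-1 (truncated at 0). *)
Fixpoint rows (n d c : nat) : seq (seq nat) :=
  match n, d with
  | 0, _ => [:: [::]]
  | n'.+1, 0 => [::]
  | n'.+1, d'.+1 => map (cons c) (rows n' d'.-1 c.+2) ++ rows n d' c.+1
  end.

Lemma mem_rows n d c s : (s \in rows n d c) =
  [&& size s == n, sorted gap2 s & all (fun x => (c <= x < c + d)%N) s].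
Proof.
have [m] := ubnP d; elim: m n d c s => // m IH [|n] [|d] c s dm.
- by case: s.
- by case: s.
- by case: s => [|x s] //=; rewrite in_nil; apply/esym/negP; lia.
rewrite /= mem_cat IH //.
have cons_mem : (s \in map (cons c) (rows n d.-1 c.+2)) =
    [&& size s == n.+1, sorted gap2 s,
        all (fun x => (c <= x < c + d.+1)%N) s & head 0%N s == c].
  case: s => [|x s]; first by apply/negP => /mapP[].
  rewrite /= eqSS (path_sortedE gap2_trans).
  have [-> | xc] := eqVneq x c; last first.
    by rewrite !andbF; apply/negP => /mapP[t _ [xc' _]]; rewrite xc' eqxx in xc.
  rewrite mem_map => [|u v [] //]; rewrite IH; last by lia.
  (* The range allowed for the tail encodes the gap after [c]. At [d = 0] the truncated length
     leaves an empty interval, and no entry meets the right side either. *)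
  have -> : all (fun x => (c.+2 <= x < c.+2 + d.-1)%N) s =
      all (gap2 c) s && all (fun x => (c <= x < c + d.+1)%N) s.
    by rewrite -all_predI; apply: eq_all => y; rewrite /= /gap2; lia.
  have -> : (c <= c < c + d.+1)%N by lia.
  by rewrite /= andbT -!andbA; congr (_ && _); rewrite andbCA.
rewrite cons_mem; case: s {cons_mem} => [|x s] //=.
rewrite (path_sortedE gap2_trans) eqSS; case: eqP => //= _.
case gt_x: (all (gap2 x) s) => //=; case: (sorted gap2 s) => //=.
have [-> | xc] := eqVneq x c; first by rewrite andbT ltnn /= orbF.
rewrite andbF /=.
have -> : (c <= x < c + d.+1)%N = (c < x < c.+1 + d)%N by lia.
(* The gap puts the tail above [x > c], so the lower bounds [c] and [c.+1] agree on it. *)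
case cx: (c < x < _)%N => //=; apply: eq_in_all => y /(allP gt_x).
by rewrite /gap2; lia.
Qed.

Lemma uniq_rows n d c : uniq (rows n d c).
Proof.
elim/ltn_ind: d n c => -[|d] IH [|n] c //=.
rewrite cat_uniq map_inj_uniq => [|u v [] //]; rewrite !IH //; last lia.
rewrite andbT; apply/hasPn => s; rewrite mem_rows => /and3P[_ _].
move=> sc; apply/negP => /mapP[t _ st]; move: sc; rewrite st /=; lia.
Qed.

Definition row_poly n d c : {poly int} := \sum_(s <- rows n d c) 'X^(sumn s).

Lemma row_polyS n d c : row_poly n.+1 d.+1 c =
  'X^c * row_poly n d.-1 c.+2 + row_poly n.+1 d c.+1.
Proof.
rewrite /row_poly /= big_cat big_map /= mulr_sumr; congr (_ + _).
by apply: eq_bigr => s _; rewrite exprD.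
Qed.

Lemma qpochS n : qpoch n.+1 = qpoch n * (1 - 'X^(n.+1)).
Proof. by rewrite /qpoch big_nat_recr. Qed.

(** The exponent is the sum of the least row [c, c + 2, ..., c + 2(n - 1)]. The modulus survives the
    recursion because [c.+1 + d] equals [c + d.+1] and [c.+2 + d.-1] is at least that. *)
Lemma row_poly_qpoch n d c :
  eqmodX (c + d) (row_poly n d c * qpoch n) 'X^(n * n.-1 + n * c).
Proof.
elim/ltn_ind: d n c => d IH [|n] c.
  by rewrite /row_poly /rows; case: d {IH} => [|d];
    rewrite big_seq1 /qpoch big_nil mulr1.
case: d IH => [|d] IH.
  (* No row of positive length fits in an empty interval, and the exponent on the right is at least
     the modulus [c]. *)
  by rewrite /row_poly big_nil mul0r; apply: eqmodX0Xn; nia.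
rewrite row_polyS mulrDl.
(* The exponent follows the recursion of the rows: removing [c] from the least row leaves the least
   row from [c.+2], and raising [c] by one adds [n.+1]. *)
have -> : 'X^(n.+1 * n.+1.-1 + n.+1 * c) =
    'X^c * (1 - 'X^(n.+1)) * 'X^(n * n.-1 + n * c.+2)
      + 'X^(n.+1 * n.+1.-1 + n.+1 * c.+1) :> {poly int}.
  have -> : (n.+1 * n.+1.-1 + n.+1 * c = c + (n * n.-1 + n * c.+2))%N by nia.
  have -> : (n.+1 * n.+1.-1 + n.+1 * c.+1 = c + n.+1 + (n * n.-1 + n * c.+2))%N
    by nia.
  by rewrite !exprD; ring.
apply: eqmodXD; last first.
  by apply: eqmodX_le (IH d _ n.+1 c.+1) => //; lia.
have -> : 'X^c * row_poly n d.-1 c.+2 * qpoch n.+1 =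
    'X^c * (1 - 'X^(n.+1)) * (row_poly n d.-1 c.+2 * qpoch n).
  by rewrite qpochS; ring.
apply: eqmodXM => //; apply: eqmodX_le (IH d.-1 _ n c.+2); lia.
Qed.

(** * Linear independence of the roots [gamma j] *)

Lemma gammaE l (j : 'I_l) :
  gamma j = delta_mx 0 (widen_ord (leqnSn l) j) - delta_mx 0 ord_max.
Proof.
(* With this sign each simple root is [e k.+1 - e k], so the sum telescopes; [inord] lets [k] run
   over the naturals. *)
pose e k : 'rV[int]_l.+1 := - delta_mx 0 (inord k).
rewrite /gamma; transitivity (\sum_(j <= k < l) (e k.+1 - e k)).
  rewrite big_geq_mkord; apply: eq_bigr => k _.
  rewrite /simple_root /e opprK addrC.
  by congr (- delta_mx _ _ + delta_mx _ _); apply: val_inj;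
    rewrite /= inordK // ltnS ?(ltnW (ltn_ord k)).
rewrite telescope_sumr ?(ltnW (ltn_ord j)) // /e opprK addrC.
by congr (delta_mx _ _ - delta_mx _ _); apply: val_inj;
  rewrite /= inordK // ltnS ?(ltnW (ltn_ord j)).
Qed.

(** Among the first [l] coordinates, [gamma j] is nonzero only at [j], where it is 1, so these
    coordinates of the sum read off the multiplicities. *)
Lemma gamma_sum_inj l (n m : 'I_l -> nat) :
  \sum_(j < l) gamma j *+ n j = \sum_(j < l) gamma j *+ m j -> n =1 m.
Proof.
have coord (p : 'I_l -> nat) i :
    (\sum_(j < l) gamma j *+ p j) 0 (widen_ord (leqnSn l) i) = (p i)%:Z.
  rewrite summxE (bigD1 i) //= big1 => [|j ji]; last first.
    rewrite mulmxnE gammaE !mxE !eqxx /= -!val_eqE /=.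
    rewrite [(i == j :> nat)]eq_sym val_eqE (negbTE ji) ltn_eqF ?ltn_ord //.
    by rewrite subr0 mul0rn.
  rewrite mulmxnE gammaE !mxE !eqxx /= -!val_eqE /= ltn_eqF ?ltn_ord //.
  by rewrite subr0 addr0 pmulrn intz.
by move=> nm i; have := coord n i; rewrite nm coord => -[].
Qed.

(** * Decoupling of the basis conditions, and the character as a product over rows *)

Definition row_start l (r : nat) (n : 'I_l -> nat) (j : 'I_l) : nat :=
  (1 + \sum_(i < l | (i < j)%N) n i + (j < r))%N.

(** The lower bound is computed from the prescribed [n] and not from the sizes of the rows of [b],
    so the condition on row [j] no longer involves the other rows. *)
Lemma basis_weightP l r (n : 'I_l -> nat) (b : monomial l) :
  basis_monomials r b /\ mon_weight b = \sum_(j < l) gamma j *+ n j <->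
  forall j, [&& size (b j) == n j, sorted gap2 (b j)
              & all (leq (row_start r n j)) (b j)].
Proof.
split=> [[[ini dif] /gamma_sum_inj szb] j | bP].
  have nE : row_start r n j = row_start r (fun i => size (b i)) j.
    by rewrite /row_start; under eq_bigr do rewrite -szb.
  rewrite szb eqxx nE /=; apply/andP; split.
    by apply/(sortedP 0%N) => i; apply: dif.
  by apply/(all_nthP 0%N) => i; apply: ini.
have szb j : size (b j) = n j by have /and3P[/eqP] := bP j.
split; last by apply: eq_bigr => j _; rewrite szb.
split=> j i ij; have /and3P[_ gap start] := bP j.
  under eq_bigr do rewrite szb.
  by have /(all_nthP 0%N) := start; apply.
by have /(sortedP 0%N) := gap; apply.
Qed.

(** Moves a sum over a list in a possibly infinite type to a finite index type, as distributing a
    product over sums requires. *)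
Lemma big_seq_preim (V : nmodType) (T : eqType) (J : finType) (v : J -> T)
    (L : seq T) (F : T -> V) :
  injective v -> uniq L -> {subset L <= codom v} ->
  \sum_(s <- L) F s = \sum_(t | v t \in L) F (v t).
Proof.
move=> vI uL sub; rewrite -(big_filter (index_enum J)) -(big_map v predT F).
apply: perm_big; apply: uniq_perm => //.
  by rewrite map_inj_uniq // filter_uniq // index_enum_uniq.
move=> s; apply/idP/mapP => [sL | [t]]; last first.
  by rewrite mem_filter => /andP[? _] ->.
have /codomP[t st] := sub _ sL.
by exists t; rewrite // mem_filter -st sL mem_index_enum.
Qed.

Lemma leq_sumn (s : seq nat) x : x \in s -> (x <= sumn s)%N.
Proof. by move=> xs; rewrite sumnE (big_rem x) //= leq_addr. Qed.

(** Expanding the product picks one row for each [j], that is, a basis monomial of the given weight,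
    and the exponent is its degree. The bound [K] is kept apart from [k] so that a single product
    serves all coefficients up to [K]. *)
Lemma character_coef l r (n : 'I_l -> nat) (K k : nat) : (k <= K)%N ->
  character r (\sum_(j < l) gamma j *+ n j) k =
  (\prod_(j < l) row_poly (n j) K.+1 (row_start r n j))`_k.
Proof.
move=> kK; pose R j := rows (n j) K.+1 (row_start r n j).
(* The rows for all [j] in one list, so that choices of rows are functions into a single finite
   type. *)
pose U : seq (seq nat) := flatten [seq R j | j <- enum 'I_l].
have subU j : {subset R j <= codom (val : seq_sub U -> seq nat)}.
  move=> s sR; have sU : s \in U.
    by apply/flatten_mapP; exists j; rewrite ?mem_enum.
  by apply/codomP; exists (SeqSub sU).
have -> : \prod_(j < l) row_poly (n j) K.+1 (row_start r n j) =
    \prod_(j < l) \sum_(t : seq_sub U | val t \in R j) 'X^(sumn (val t)).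
  apply: eq_bigr => j _.
  exact: big_seq_preim val_inj (uniq_rows _ _ _) (@subU j).
rewrite bigA_distr_big_dep coef_sum.
pose deg (f : {ffun 'I_l -> seq_sub U}) := (\sum_j sumn (val (f j)))%N.
have degE (f : {ffun 'I_l -> seq_sub U}) :
    (\prod_j 'X^(sumn (val (f j))))`_k = (deg f == k)%:R :> int.
  by rewrite -expr_sum coefXn eq_sym.
rewrite (eq_bigr _ (fun f _ => degE f)).
pose S := [set f : {ffun 'I_l -> seq_sub U} |
  (f \in family (fun j t => val t \in R j)) && (deg f == k)].
transitivity (#|S|%:R : int); last first.
  rewrite -sum1_card natr_sum big_mkcond [RHS]big_mkcond.
  by apply: eq_bigr => f _; rewrite inE; case: (f \in _) => //=; case: eqP.
rewrite /character natz; congr Posz.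
have mon1 : is_monomial [ffun _ : 'I_l => [::]].
  by apply/forallP => j; rewrite ffunE.
pose mk (f : {ffun 'I_l -> seq_sub U}) : monomial l :=
  insubd (Monomial mon1) [ffun j => val (f j)].
have inR f : f \in S -> forall j, val (f j) \in R j.
  by rewrite inE => /andP[/familyP fR _] j; apply: fR.
have mkE f : f \in S -> forall j, mk f j = val (f j).
  move=> fS j; rewrite /mk insubdK ?ffunE //.
  apply/forallP => i; rewrite ffunE; have := inR f fS i.
  rewrite mem_rows => /and3P[_ gap start]; apply/andP; split.
    by apply: sub_sorted gap => x y; rewrite /gap2; lia.
  by apply: sub_all start => x; rewrite /row_start; lia.
rewrite cardE -(size_map mk); apply: perm_size; apply: uniq_perm.
- exact: fset_uniq.
- rewrite map_inj_in_uniq ?enum_uniq // => f g; rewrite !mem_enum => fS gS fg.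
  by apply/ffunP => j; apply: val_inj; rewrite -!mkE // fg.
move=> b; rewrite in_fset_set; last exact: finite_basis_monomials.
apply/idP/mapP => [|[f]].
  rewrite inE /= => -[bB bw bd].
  have /basis_weightP bP := conj bB bw.
  have bR j : b j \in R j.
    have /and3P[szb gap start] := bP j.
    rewrite mem_rows szb gap; apply/allP => x xb.
    rewrite (allP start x xb) /=.
    (* An entry is at most the degree [k <= K], so the cutoff in [rows] loses no monomial of degree
       [k]. *)
    suff : (x <= k)%N by rewrite /row_start; lia.
    apply: leq_trans (leq_sumn xb) _; rewrite -bd /mon_degree (bigD1 j) //=.
    by rewrite sumnE leq_addr.
  have bU j : b j \in U by have /codomP[t ->] := subU j _ (bR j); apply: valP.
  pose f := [ffun j => SeqSub (bU j)].
  have fS : f \in S.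
    rewrite inE; apply/andP; split.
      by apply/familyP => j; rewrite ffunE; apply: bR.
    by rewrite -bd; apply/eqP; apply: eq_bigr => j _; rewrite ffunE sumnE.
  exists f; first by rewrite mem_enum.
  by apply: val_inj; apply/ffunP => j /=; rewrite mkE // ffunE.
rewrite mem_enum => fS ->; rewrite inE /=.
have := fS; rewrite inE => /andP[_ /eqP fd].
have [bB bw] : basis_monomials r (mk f) /\
    mon_weight (mk f) = \sum_(j < l) gamma j *+ n j.
  apply/basis_weightP => j; rewrite mkE //; have := inR f fS j.
  rewrite mem_rows => /and3P[-> -> start] /=.
  by apply: sub_all start => x /andP[].
split=> //; rewrite -fd /mon_degree /deg.
by apply: eq_bigr => j _; rewrite mkE // sumnE.
Qed.

Theorem corollary3 (l r : nat) (hl : (1 <= l)%N) (hr : (r <= l)%N)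
    (n : 'I_l -> nat) :
  @character l r (\sum_(i < l) gamma i *+ n i) =
  fps_div
    'X^(\sum_(i < l) n i ^ 2
        + \sum_(i < l) \sum_(j < l | (i < j)%N) n i * n j
        + \sum_(i < l | (i < r)%N) n i)
    (\prod_(i < l) qpoch (n i)).
Proof.
apply/fps_divP; first exact: qpoch_prod_coef0.
apply/funext => k; rewrite /fps_mul /fps_of_poly.
(* The convolution at [k] only involves coefficients up to [k], so the bound [K = k] suffices. *)
pose F j := row_poly (n j) k.+1 (row_start r n j).
transitivity (\sum_(i < k.+1)
    (\prod_j F j)`_i * (\prod_j qpoch (n j))`_(k - i)).
  apply: eq_bigr => i _; congr (_ * _).
  by apply: character_coef; rewrite -ltnS.
rewrite -coefM -big_split /=.
(* Each factor is known modulo ['X^(row_start r n j + k.+1)], which determines coefficient [k]. *)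
have /eqmodX_prod -> // : forall j, eqmodX k.+1 (F j * qpoch (n j))
    'X^(n j * (n j).-1 + n j * row_start r n j).
  by move=> j; exact: (eqmodX_le (leq_addl _ _) (@row_poly_qpoch _ _ _)).
rewrite -expr_sum; congr ('X^ _)`_k.
(* Exchanging the sums groups the products [n i * n j] with [i < j] by [j], as in [row_start]; the
   exponents then agree for each [j] separately. *)
rewrite (exchange_big_dep predT) //= -big_split /=.
rewrite [X in (_ + X)%N]big_mkcond -big_split /=.
apply: eq_bigr => j _; rewrite -big_distrl /row_start /=.
case: (j < r)%N; nia.
Qed.
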